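(* Let $\mathcal{R}$ be a probabilistic term rewrite system (PTRS). Then $\mathcal{R}$ is innermost almost-surely terminating (iAST) if and only if the ADP problem $\mathcal{DP}(\mathcal{R})$ of its canonical annotated dependency pairs is iAST.
   Context: Fix a finite signature $\Sigma$ and a set of variables $\mathcal{V}$. A finite multi-distribution on a nonempty set $A$ is a finite multiset $\mu$ of pairs $(p:a)$ with $0<p\le 1$, $a\in A$ and $\sum_{(p:a)\in\mu}p=1$; $\mathrm{Supp}(\mu)$ is the multiset of the elements $a$ occurring in $\mu$. A probabilistic rewrite rule is a pair $\ell\to\mu$ with $\ell\in\mathcal{T}(\Sigma,\mathcal{V})\setminus\mathcal{V}$, $\mu$ a finite multi-distribution on $\mathcal{T}(\Sigma,\mathcal{V})$ and $\mathcal{V}(r)\subseteq\mathcal{V}(\ell)$ for all $r\in\mathrm{Supp}(\mu)$; a PTRS is a finite set of such rules. $\Sigma=\mathcal{D}\uplus\mathcal{C}$, where the defined symbols $\mathcal{D}$ are the root symbols of left-hand sides of rules of $\mathcal{R}$. Innermost rewriting with $\mathcal{R}$: a term is an $\mathcal{R}$-normal form if none of its subterms is an instance $\ell\sigma$ of a left-hand side $\ell$ of $\mathcal{R}$; $\mathtt{ANF}_{\mathcal{R}}$ is the set of terms all of whose proper subterms are $\mathcal{R}$-normal forms. We write $s\overset{i}{\to}_{\mathcal{R}}\{p_1:t_1,\dots,p_k:t_k\}$ if there are a position $\pi$, a rule $\ell\to\{p_1:r_1,\dots,p_k:r_k\}\in\mathcal{R}$ and a substitution $\sigma$ with $s|_\pi=\ell\sigma\in\mathtt{ANF}_{\mathcal{R}}$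 and $t_j=s[r_j\sigma]_\pi$ for all $j$. An innermost $\mathcal{R}$-rewrite sequence tree (RST) is a (possibly infinite) directed tree $(V,E)$ with $V\neq\emptyset$ in which every node has finitely many children, together with a labeling of each node $v$ by a pair $(p_v,t_v)\in(0,1]\times\mathcal{T}(\Sigma,\mathcal{V})$ with $p_v=1$ for the root, such that whenever $v$ has children $w_1,\dots,w_k$ ($k\ge1$) then $t_v\overset{i}{\to}_{\mathcal{R}}\{\tfrac{p_{w_1}}{p_v}:t_{w_1},\dots,\tfrac{p_{w_k}}{p_v}:t_{w_k}\}$. For a tree $\mathfrak{T}$, $|\mathfrak{T}|_{\mathtt{Leaf}}=\sum_{v\text{ leaf}}p_v$. $\mathcal{R}$ is iAST if $|\mathfrak{T}|_{\mathtt{Leaf}}=1$ for every innermost $\mathcal{R}$-RST $\mathfrak{T}$. Annotations: for each $f\in\mathcal{D}$ let $f^\#$ be a fresh symbol of the same arity, $\mathcal{D}^\#=\{f^\#\mid f\in\mathcal{D}\}$, $\Sigma^\#=\Sigma\uplus\mathcal{D}^\#$; elements of $\mathcal{T}(\Sigma^\#,\mathcal{V})$ are annotated terms. For $\Sigma'\subseteq\Sigma^\#$, $\mathrm{pos}_{\Sigma'}(t)$ is the set of positions of $t$ carrying a symbol of $\Sigma'$. For $\Phi\subseteq\mathrm{pos}_{\mathcal{D}\cup\mathcal{D}^\#}(t)$, $\#_\Phi(t)$ is obtained from $t$ by annotating exactly the symbols at positions in $\Phi$ and removing all other annotations; $\flat(t)=\#_\emptyset(t)$; $\#_{\mathcal{D}}(t)=\#_{\mathrm{pos}_{\mathcal{D}}(t)}(t)$;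 $\flat_{\uparrow\pi}(t)$ removes all annotations at positions strictly above $\pi$. ADPs: an annotated dependency pair (ADP) is $\ell\to\{p_1:r_1,\dots,p_k:r_k\}^m$ with $\ell\in\mathcal{T}(\Sigma,\mathcal{V})\setminus\mathcal{V}$, a flag $m\in\{\mathsf{true},\mathsf{false}\}$, $\{p_1:r_1,\dots,p_k:r_k\}$ a finite multi-distribution on $\mathcal{T}(\Sigma^\#,\mathcal{V})$ and $\mathcal{V}(r_j)\subseteq\mathcal{V}(\ell)$ for all $j$. An ADP problem is a finite set $\mathcal{P}$ of ADPs. An annotated term $t$ is a $\mathcal{P}$-normal form if no subterm of $\flat(t)$ is an instance of a left-hand side of an ADP in $\mathcal{P}$; $\mathtt{ANF}_{\mathcal{P}}$ is the set of annotated terms all of whose proper subterms are $\mathcal{P}$-normal forms. We write $s\hookrightarrow_{\mathcal{P}}\{p_1:t_1,\dots,p_k:t_k\}$ if there are an ADP $\ell\to\{p_1:r_1,\dots,p_k:r_k\}^m\in\mathcal{P}$, a substitution $\sigma$ and a position $\pi\in\mathrm{pos}_{\mathcal{D}\cup\mathcal{D}^\#}(s)$ with $\flat(s|_\pi)=\ell\sigma\in\mathtt{ANF}_{\mathcal{P}}$ such that for all $j$: (pr) $t_j=s[r_j\sigma]_\pi$ if $\pi\in\mathrm{pos}_{\mathcal{D}^\#}(s)$ and $m=\mathsf{true}$; (p) $t_j=\flat_{\uparrow\pi}(s[r_j\sigma]_\pi)$ if $\pi\in\mathrm{pos}_{\mathcal{D}^\#}(s)$ and $m=\mathsf{false}$;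 (r) $t_j=s[\flat(r_j)\sigma]_\pi$ if $\pi\notin\mathrm{pos}_{\mathcal{D}^\#}(s)$ and $m=\mathsf{true}$; (irr) $t_j=\flat_{\uparrow\pi}(s[\flat(r_j)\sigma]_\pi)$ if $\pi\notin\mathrm{pos}_{\mathcal{D}^\#}(s)$ and $m=\mathsf{false}$. Chain trees: a $\mathcal{P}$-chain tree (CT) is $\mathfrak{T}=(V,E,L,V_P)$ where (1) $(V,E)$ is a (possibly infinite) directed tree with $V\ne\emptyset$ and every node having finitely many children; (2) $L$ labels every node $v$ by $(p_v,t_v)\in(0,1]\times\mathcal{T}(\Sigma^\#,\mathcal{V})$ with $p_v=1$ for the root; (3) $V_P$ is a subset of the inner nodes, and $V_R$ denotes the inner nodes not in $V_P$; (4) if $v\in V_P$ has children $w_1,\dots,w_k$ then $t_v\hookrightarrow_{\mathcal{P}}\{\tfrac{p_{w_1}}{p_v}:t_{w_1},\dots,\tfrac{p_{w_k}}{p_v}:t_{w_k}\}$ by case (pr) or (p); (5) if $v\in V_R$ has children $w_1,\dots,w_k$, the same holds by case (r) or (irr); (6) every infinite path of $\mathfrak{T}$ contains infinitely many nodes of $V_P$. $\mathcal{P}$ is iAST if $|\mathfrak{T}|_{\mathtt{Leaf}}=1$ for all $\mathcal{P}$-CTs $\mathfrak{T}$. Canonical ADPs: for a rule $\ell\to\{p_1:r_1,\dots,p_k:r_k\}$, its canonical ADP is $\ell\to\{p_1:\#_{\mathcal{D}}(r_1),\dots,p_k:\#_{\mathcal{D}}(r_k)\}^{\mathsf{true}}$,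 and $\mathcal{DP}(\mathcal{R})$ is the set of canonical ADPs of the rules of $\mathcal{R}$. *)

(* Defs.v *)
From HB Require Import structures.
From mathcomp Require Import all_boot all_order all_algebra.
From mathcomp Require Import all_classical all_reals all_analysis.

Set Implicit Arguments.
Unset Strict Implicit.
Unset Printing Implicit Defensive.

Import Order.TTheory GRing.Theory Num.Theory.
Local Open Scope classical_set_scope.
Local Open Scope ring_scope.

Record signature := Signature {
  symbol :> finType;
  arity : symbol -> nat
}.

Section Terms.
Variables (S : signature) (V : Type).

Inductive term :=
| Var of V
| App (f : S) of ('I_(arity f) -> term).

Definition is_var (t : term) := if t is Var _ then true else false.

Definition root_symbol (t : term) : option S :=
  if t is App f _ then Some f else None.

Fixpoint vars (t : term) : set V :=
  match t with
  | Var x => [set x]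
  | App f ts => \bigcup_(i in [set: 'I_(arity f)]) vars (ts i)
  end.

Fixpoint subst (sigma : V -> term) (t : term) : term :=
  match t with
  | Var x => sigma x
  | App f ts => App (fun i => subst sigma (ts i))
  end.

(* Arguments are numbered from 0. *)
Definition position := seq nat.

(* [t|_p], with [None] when [p] is not a position of [t]. *)
Fixpoint subterm_at (t : term) (p : position) : option term :=
  match p, t with
  | [::], _ => Some t
  | i :: q, App f ts =>
      if (insub i : option 'I_(arity f)) is Some j
      then subterm_at (ts j) q else None
  | _ :: _, Var _ => None
  end.

(* [t[u]_p]; equal to [t] when [p] is not a position of [t]. *)
Fixpoint replace_at (t : term) (p : position) (u : term) : term :=
  match p, t with
  | [::], _ => u
  | i :: q, App f ts =>
      App (fun j : 'I_(arity f) =>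
             if j == i :> nat then replace_at (ts j) q u else ts j)
  | _ :: _, Var _ => t
  end.

Definition positions_of (S' : set S) (t : term) : set position :=
  [set p | exists u f,
     [/\ subterm_at t p = Some u, root_symbol u = Some f & S' f]].

HB.instance Definition _ := gen_eqMixin term.
HB.instance Definition _ := gen_choiceMixin term.

End Terms.

Section Annotations.
Variables (S : signature) (D : set S) (V : Type).

(* [S] together with a fresh copy of [D]: the symbol [(f, false)] stands for
   [f] and, only for [f] in [D], [(f, true)] stands for the annotated [f]. *)
Definition ann_symbol := {g : S * bool | g.2 ==> (g.1 \in D)}.

Definition ann_signature : signature :=
  @Signature ann_symbol (fun g => arity (sval g).1).

Definition aterm := term ann_signature V.

Lemma ann_symbol_proof (f : S) (b : bool) :
  let g := (f, b && (f \in D)) in g.2 ==> (g.1 \in D).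
Proof. by case: b => //=; apply/implyP. Qed.

(* The annotated copy of [f] if [b] holds and [f] is in [D], else [f]. *)
Definition mark (f : S) (b : bool) : ann_signature :=
  exist _ (f, b && (f \in D)) (ann_symbol_proof f b).

Definition symD : set ann_signature :=
  [set g : ann_symbol | (sval g).1 \in D /\ ~~ (sval g).2].

Definition symDsharp : set ann_signature := [set g : ann_symbol | (sval g).2].

Fixpoint embed (t : term S V) : aterm :=
  match t with
  | Var x => Var ann_signature x
  | App f ts => @App ann_signature V (mark f false) (fun i => embed (ts i))
  end.

(* #_Phi(t); positions of [Phi] that do not carry a symbol of [D] or of its
   annotated copy are ignored. *)
Fixpoint annotate (Phi : set position) (t : aterm) : aterm :=
  match t with
  | Var x => Var ann_signature x
  | App g ts =>
      @App ann_signature V (mark (sval g).1 ([::] \in Phi))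
        (fun i => annotate [set p | Phi (nat_of_ord i :: p)] (ts i))
  end.

Definition flat (t : aterm) : aterm := annotate set0 t.

Definition annotate_defined (t : term S V) : aterm :=
  annotate (positions_of symD (embed t)) (embed t).

Definition strictly_above (p q : position) : bool := prefix p q && (p != q).

Definition flat_above (pi : position) (t : aterm) : aterm :=
  annotate [set p | positions_of symDsharp t p /\ ~~ strictly_above p pi] t.

End Annotations.

Section MultiDistributions.
Variable R : realType.

(* Finite multisets of pairs are represented by sequences; wherever two of
   them are compared below, this is done up to permutation. *)
Definition mdist (A : Type) := seq (R * A).

Definition is_mdist (A : Type) (mu : mdist A) : Prop :=
  all (fun x => 0 < x.1 <= 1) mu /\ \sum_(x <- mu) x.1 = 1.

Definition mdist_map (A B : Type) (h : A -> B) (mu : mdist A) : mdist B :=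
  [seq (x.1, h x.2) | x <- mu].

Definition supp (A : Type) (mu : mdist A) : seq A := [seq x.2 | x <- mu].

End MultiDistributions.

Section LabeledTrees.
Variable R : realType.

Record labeled_tree (A : Type) := LabeledTree {
  node : choiceType;
  root : node;
  edge : rel node;
  prob : node -> R;
  label : node -> A;
  tree_unique_path :
    forall v, exists! s : seq node, path edge root s /\ last root s = v;
  tree_finite_children : forall v, finite_set [set w | edge v w];
  tree_prob : forall v, 0 < prob v <= 1;
  tree_prob_root : prob root = 1
}.

Variables (A : Type) (T : labeled_tree A).

Definition leaf (v : node T) : Prop := forall w, ~~ edge v w.

Definition children (v : node T) (ws : seq (node T)) : Prop :=
  uniq ws /\ forall w, (w \in ws) = edge v w.

Definition children_dist (v : node T) (ws : seq (node T)) : mdist R A :=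
  [seq (prob w / prob v, label w) | w <- ws].

Definition infinite_path (x : nat -> node T) : Prop :=
  forall n, edge (x n) (x n.+1).

Definition leaf_weight : \bar R := \esum_(v in [set v | leaf v]) (prob v)%:E.

End LabeledTrees.

Section PTRS.
Variables (R : realType) (S : signature) (V : Type).

Record rule := Rule {
  lhs : term S V;
  rhs : mdist R (term S V)
}.

Definition is_rule (rl : rule) : Prop :=
  [/\ ~~ is_var (lhs rl),
      is_mdist (rhs rl) &
      forall r, r \in supp (rhs rl) -> vars r `<=` vars (lhs rl)].

Definition is_PTRS (Rs : set rule) : Prop :=
  finite_set Rs /\ forall rl, Rs rl -> is_rule rl.

Variable Rs : set rule.

Definition defined_symbols : set S :=
  [set f | exists rl, Rs rl /\ root_symbol (lhs rl) = Some f].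

Definition normal_form (t : term S V) : Prop :=
  forall p u, subterm_at t p = Some u ->
    ~ exists rl sigma, Rs rl /\ u = subst sigma (lhs rl).

Definition ANF (t : term S V) : Prop :=
  forall p u, p <> [::] -> subterm_at t p = Some u -> normal_form u.

Definition istep (s : term S V) (mu : mdist R (term S V)) : Prop :=
  exists (pi : position) (rl : rule) (sigma : V -> term S V),
    [/\ Rs rl,
        subterm_at s pi = Some (subst sigma (lhs rl)),
        ANF (subst sigma (lhs rl)) &
        perm_eq mu
          (mdist_map (fun r => replace_at s pi (subst sigma r)) (rhs rl))].

Definition is_RST (T : labeled_tree R (term S V)) : Prop :=
  forall (v : node T) (ws : seq (node T)),
    children v ws -> ws <> [::] -> istep (label v) (children_dist v ws).

Definition iAST : Prop :=
  forall T : labeled_tree R (term S V), is_RST T -> leaf_weight T = 1%:E.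

End PTRS.

Section ADPProblems.
Variables (R : realType) (S : signature) (D : set S) (V : Type).

Record adp := ADP {
  alhs : term S V;
  arhs : mdist R (aterm D V);
  aflag : bool
}.

Definition is_adp (a : adp) : Prop :=
  [/\ ~~ is_var (alhs a),
      is_mdist (arhs a) &
      forall r, r \in supp (arhs a) -> vars r `<=` vars (alhs a)].

Definition is_ADP_problem (P : set adp) : Prop :=
  finite_set P /\ forall a, P a -> is_adp a.

Variable P : set adp.

Definition P_normal_form (t : aterm D V) : Prop :=
  forall p u, subterm_at (flat t) p = Some u ->
    ~ exists a sigma, P a /\ u = subst sigma (embed D (alhs a)).

Definition P_ANF (t : aterm D V) : Prop :=
  forall p u, p <> [::] -> subterm_at t p = Some u -> P_normal_form u.

Variant adp_case := Case_pr | Case_p | Case_r | Case_irr.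

(* [annotated]: does the redex position carry an annotated symbol? *)
Definition case_of (annotated m : bool) : adp_case :=
  match annotated, m with
  | true, true => Case_pr
  | true, false => Case_p
  | false, true => Case_r
  | false, false => Case_irr
  end.

Definition contract (c : adp_case) (s : aterm D V) (pi : position)
    (sigma : V -> aterm D V) (r : aterm D V) : aterm D V :=
  match c with
  | Case_pr => replace_at s pi (subst sigma r)
  | Case_p => flat_above pi (replace_at s pi (subst sigma r))
  | Case_r => replace_at s pi (subst sigma (flat r))
  | Case_irr => flat_above pi (replace_at s pi (subst sigma (flat r)))
  end.

Definition adp_step (c : adp_case) (s : aterm D V)
    (mu : mdist R (aterm D V)) : Prop :=
  exists (a : adp) (sigma : V -> aterm D V) (pi : position) (u : aterm D V),
    [/\ P a,
        positions_of (@symD S D `|` @symDsharp S D) s pi,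
        subterm_at s pi = Some u /\ flat u = subst sigma (embed D (alhs a)),
        P_ANF (subst sigma (embed D (alhs a))) &
        c = case_of (pi \in positions_of (@symDsharp S D) s) (aflag a) /\
        perm_eq mu (mdist_map (contract c s pi sigma) (arhs a))].

Definition is_CT (T : labeled_tree R (aterm D V)) (VP : set (node T)) : Prop :=
  [/\ forall v, VP v -> ~ leaf v,
      forall (v : node T) (ws : seq (node T)), VP v -> children v ws ->
        adp_step Case_pr (label v) (children_dist v ws) \/
        adp_step Case_p (label v) (children_dist v ws),
      forall (v : node T) (ws : seq (node T)),
        ~ leaf v -> ~ VP v -> children v ws ->
        adp_step Case_r (label v) (children_dist v ws) \/
        adp_step Case_irr (label v) (children_dist v ws) &
      forall x : nat -> node T, infinite_path x ->
        infinite_set (range x `&` VP)].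

Definition adp_iAST : Prop :=
  forall (T : labeled_tree R (aterm D V)) (VP : set (node T)),
    is_CT VP -> leaf_weight T = 1%:E.

End ADPProblems.

Section DependencyPairs.
Variables (R : realType) (S : signature) (V : Type).

Definition canonical_adp (D : set S) (rl : rule R S V) : adp R D V :=
  ADP (lhs rl) (mdist_map (@annotate_defined S D V) (rhs rl)) true.

Definition DP (Rs : set (rule R S V)) : set (adp R (defined_symbols Rs) V) :=
  canonical_adp (defined_symbols Rs) @` Rs.
Arguments DP Rs _ : clear implicits.

Lemma vars_annotate_embed (D : set S) (t : term S V) (Phi : set position) :
  vars (annotate Phi (embed D t)) = vars t.
Proof.
elim: t Phi => [x|f ts IH] Phi //=.
by apply: eq_bigcupr => i _; exact: IH.
Qed.

Lemma DP_is_ADP_problem (Rs : set (rule R S V)) :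
  is_PTRS Rs -> is_ADP_problem (DP Rs).
Proof.
move=> [fR wR]; split; first exact: finite_image.
move=> _ [rl /wR [nv [pr sm] vs] <-]; split => //=.
  by split; [rewrite all_map|rewrite big_map].
move=> r; rewrite /supp -map_comp => /mapP[/= x xrl ->].
rewrite /annotate_defined vars_annotate_embed; apply: vs.
by apply/mapP; exists x.
Qed.

End DependencyPairs.

Arguments DP {R S V} Rs _.

(* Main.v *)
Require Import Defs.
From HB Require Import structures.
From mathcomp Require Import all_boot all_order all_algebra.
From mathcomp Require Import all_classical all_reals all_analysis.

(** Both directions keep the tree and only change the labels.  Erasing the
    annotations turns a chain tree into a rewrite sequence tree.  Conversely,
    annotate all defined symbols of the root and propagate annotations downwards
    along the tree.  The invariant is that an unannotated defined symbol is
    always the root of a normal form: the only annotations that a step loses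
    are inside the matching substitution, and innermost rewriting instantiates
    the variables by normal forms.  Hence every redex is annotated, every step
    is of kind (pr), and all inner nodes can be put in [V_P]. *)

Set Implicit Arguments.
Unset Strict Implicit.
Unset Printing Implicit Defensive.

Import Order.TTheory GRing.Theory Num.Theory.
(* Restores [root] and [contract], which the libraries above shadow. *)
Import Defs.
Local Open Scope classical_set_scope.
Local Open Scope ring_scope.

(** * Subterms of instances *)

Section Terms.
Variables (S : signature) (V : Type).
Implicit Types t : term S V.

(* Not a conversion: [subterm_at] recurses on the term. *)
Lemma subterm_at_nil t : subterm_at t [::] = Some t.
Proof. by case: t. Qed.

Lemma subterm_at_cons (f : S) (ts : 'I_(arity f) -> term S V)
    (i : 'I_(arity f)) (p : position) :
  subterm_at (App ts) (nat_of_ord i :: p) = subterm_at (ts i) p.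
Proof. by rewrite /= valK. Qed.

(** The condition [p <> [::]] makes [sigma x] a proper subterm of a redex, so that [ANF] forces it
    to be normal. *)
Lemma subterm_at_subst_var (sigma : V -> term S V) t (x : V) :
  vars t x -> exists p, subterm_at (subst sigma t) p = Some (sigma x) /\
    (~~ is_var t -> p <> [::]).
Proof.
elim: t => [y|f ts IH] /=.
  by move=> ->; exists [::]; rewrite subterm_at_nil.
move=> [i _ /IH [p [hp _]]]; exists (nat_of_ord i :: p); split=> //.
by rewrite valK.
Qed.

End Terms.

(** * Erasing annotations *)

Section Erase.
Variables (S : signature) (D : set S) (V : Type).
Implicit Types (t : term S V) (a : aterm D V).

(** Unlike [flat], this leaves the annotated signature, so its values can label a rewrite sequence
    tree. *)
Fixpoint erase a : term S V :=
  match a with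
  | Var x => Var S x
  | App g ts => @App S V (sval g).1 (fun i => erase (ts i))
  end.

Lemma erase_embed : cancel (@embed S D V) erase.
Proof. by elim=> [x|f ts IH] //=; congr App; apply/funext. Qed.

Lemma erase_annotate Phi a : erase (annotate Phi a) = erase a.
Proof.
elim: a Phi => [x|g ts IH] Phi //=.
by congr App; apply/funext => i; apply: IH.
Qed.

Lemma flat_erase a : flat a = embed D (erase a).
Proof.
(* [annotate] shifts its set at each recursive call, so the induction ranges over all sets contained
   in [set0]. *)
rewrite /flat; have: (set0 : set position) `<=` set0 by [].
elim: a {1 3}set0 => [x|g ts IH] Phi Phi0 //=.
have -> : ([::] \in Phi) = false by apply/negbTE/negP; rewrite inE => /Phi0.
by congr App; apply/funext => i; apply: IH => p /Phi0.
Qed.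

Lemma erase_subst (sigma : V -> aterm D V) a :
  erase (subst sigma a) = subst (erase \o sigma) (erase a).
Proof. by elim: a => [x|g ts IH] //=; congr App; apply/funext. Qed.

Lemma embed_subst (sigma : V -> term S V) t :
  embed D (subst sigma t) = subst (@embed S D V \o sigma) (embed D t).
Proof. by elim: t => [x|g ts IH] //=; congr App; apply/funext. Qed.

Lemma erase_replace_at a p b :
  erase (replace_at a p b) = replace_at (erase a) p (erase b).
Proof.
elim: p a => [|i p IH] [x|g ts] //=.
by congr App; apply/funext => j; case: ifP.
Qed.

Lemma subterm_at_erase a p :
  subterm_at (erase a) p = omap erase (subterm_at a p).
Proof. by elim: p a => [|i p IH] [x|g ts] //=; case: insub => /=. Qed.

Lemma subterm_at_embed t p :
  subterm_at (embed D t) p = omap (@embed S D V) (subterm_at t p).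
Proof. by elim: p t => [|i p IH] [x|g ts] //=; case: insub => /=. Qed.

Lemma erase_annotate_defined t : erase (annotate_defined D t) = t.
Proof. by rewrite /annotate_defined erase_annotate erase_embed. Qed.

(** Both symbols have arity [arity f] by computation, so [ts] keeps its type while the equality of
    flags is eliminated. *)
Lemma App_mark (f : S) (b b' : bool) (ts : 'I_(arity f) -> aterm D V) :
  b && (f \in D) = b' && (f \in D) ->
  @App (ann_signature D) V (mark D f b) ts =
  @App (ann_signature D) V (mark D f b') ts.
Proof.
rewrite /mark; move: (ann_symbol_proof D f b) (ann_symbol_proof D f b') => /=.
by move=> h h' e; case: _ / e h' => h'; rewrite (bool_irrelevance h h').
Qed.

(** Trades the global set of defined positions for a recursion on the term; [mark] ignores the flag
    [true] when [f] is outside [D]. *)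
Lemma annotate_defined_App (f : S) (ts : 'I_(arity f) -> term S V) :
  annotate_defined D (App ts) =
  @App (ann_signature D) V (mark D f true) (fun i => annotate_defined D (ts i)).
Proof.
rewrite /annotate_defined /=.
rewrite (App_mark (b' := true)); last first.
  case: (boolP (f \in D)) => fD; last by rewrite !andbF.
  congr andb; apply: mem_set.
  by exists (embed D (App ts)), (mark D f false).
congr App; apply/funext => i; congr annotate; apply/seteqP.
by split=> p [u [g [+ gu Dg]]]; [rewrite /= valK|]; exists u, g;
   split=> //=; rewrite ?valK.
Qed.

(** The four cases differ in annotations only. *)
Lemma erase_contract c a p sigma r :
  erase (contract c a p sigma r) =
  replace_at (erase a) p (subst (erase \o sigma) (erase r)).
Proof.
by case: c; rewrite /contract /flat_above ?erase_annotate erase_replace_at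
  erase_subst /flat ?erase_annotate.
Qed.

End Erase.

(** * Relabelling trees and recursion along paths *)

Section Trees.
Variable R : realType.

(** Nodes, edges and probabilities are kept, so [leaf_weight] is unchanged by conversion. *)
Definition relabel (A B : Type) (T : labeled_tree R A) (l : node T -> B) :
    labeled_tree R B :=
  LabeledTree l (tree_unique_path (l:=T)) (tree_finite_children (l:=T))
    (tree_prob (l:=T)) (tree_prob_root T).

Variables (A : Type) (T : labeled_tree R A).

Lemma children_exist (v : node T) : exists ws, children v ws.
Proof.
have /finite_seqP[s sE] := tree_finite_children v.
exists (undup s); split; first exact: undup_uniq.
move=> w; rewrite mem_undup.
have -> : (w \in s) = (w \in [set` s]) by apply/idP/idP; rewrite inE.
by rewrite -sE; apply/idP/idP; rewrite inE.
Qed.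

Lemma children_perm (v : node T) ws ws' :
  children v ws -> children v ws' -> perm_eq ws ws'.
Proof.
by move=> [u e] [u' e']; apply: uniq_perm => // w; rewrite e e'.
Qed.

Lemma children_leaf (v : node T) ws : children v ws -> ~ leaf v -> ws <> [::].
Proof.
by move=> [_ e] nl ws0; apply: nl => w; rewrite -e ws0.
Qed.

Definition path_to (v : node T) : seq (node T) :=
  xget [::] [set s | path (@edge _ _ T) (root T) s /\ last (root T) s = v].

Lemma path_toE (s : seq (node T)) :
  path (@edge _ _ T) (root T) s -> path_to (last (root T) s) = s.
Proof.
move=> ps; have [s0 [_ u]] := tree_unique_path (last (root T) s).
rewrite /path_to; case: xgetP => [s' _ s'P|/(_ s)[]//].
exact: etrans (esym (u _ s'P)) (u _ (conj ps erefl)).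
Qed.

Lemma path_toP (v : node T) :
  path (@edge _ _ T) (root T) (path_to v) /\ last (root T) (path_to v) = v.
Proof.
have [s [[ps <-] _]] := tree_unique_path v.
by rewrite path_toE.
Qed.

Lemma path_to_child (v w : node T) :
  edge v w -> path_to w = rcons (path_to v) w.
Proof.
move=> vw; have [pv lv] := path_toP v.
rewrite -[w in LHS](last_rcons (root T) (path_to v) w) path_toE //.
by rewrite rcons_path pv lv.
Qed.

(** The depth, measured as the length of [path_to], grows by one along each edge. *)
Lemma infinite_path_inj (x : nat -> node T) : infinite_path x -> injective x.
Proof.
move=> xP; have sz n : size (path_to (x n)) = (size (path_to (x 0%N)) + n)%N.
  elim: n => [|n IH]; first by rewrite addn0.
  by rewrite (path_to_child (xP n)) size_rcons IH addnS.
by move=> m n /(congr1 (fun v => size (path_to v))); rewrite (sz m) (sz n) => /addnI.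
Qed.

(** Recursion from the root downwards: the label of [v] is the fold of [F] along the unique path
    from the root to [v]. *)
Lemma label_along_tree (B : Type) (Q : node T -> B -> Prop) (b0 : B)
    (F : node T -> B -> node T -> B) :
  Q (root T) b0 -> (forall v w b, edge v w -> Q v b -> Q w (F v b w)) ->
  exists l : node T -> B, (forall v, Q v (l v)) /\
    forall v w, edge v w -> l w = F v (l v) w.
Proof.
move=> Q0 QF.
pose fix walk (v : node T) b s :=
  if s is w :: s' then walk w (F v b w) s' else b.
have walk_rcons v b s w :
    walk v b (rcons s w) = F (last v s) (walk v b s) w.
  by elim: s v b => //= w' s IH v b.
exists (fun v => walk (root T) b0 (path_to v)); split=> [v|v w vw]; last first.
  by rewrite (path_to_child vw) walk_rcons (path_toP v).2.
have [+ lv] := path_toP v; rewrite -[v in Q v]lv.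
elim: (path_to v) (root T) b0 Q0 => //= w s IH u b Qu /andP[uw ps].
by apply: IH => //; apply: QF.
Qed.

End Trees.

(** * Normal forms and steps under erasure *)

Section MainProof.
Variables (R : realType) (S : signature) (V : Type).
Variable Rs : set (rule R S V).
Let D := defined_symbols Rs.
Implicit Types (t : term S V) (a s : aterm D V).

Lemma normal_form_sub t p u :
  normal_form Rs t -> subterm_at t p = Some u -> normal_form Rs u.
Proof.
move=> nt tp q w uq; apply: (nt (p ++ q)).
elim: p t tp {nt} => [|i p IH] t; first by rewrite subterm_at_nil => -[->].
by case: t => [x|f ts] //=; case: insub => // j; exact: IH.
Qed.

Lemma redex_not_normal rl sigma :
  Rs rl -> ~ normal_form Rs (subst sigma (lhs rl)).
Proof. by move=> rlR /(_ [::] _ (subterm_at_nil _)); apply; exists rl, sigma. Qed.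

(** [embed] carries a matching substitution to the annotated side, and [erase] carries one back. *)
Lemma P_normal_formE a : P_normal_form (DP Rs) a <-> normal_form Rs (erase a).
Proof.
rewrite /P_normal_form flat_erase; split=> na p u.
- move=> ap [rl [sigma [rlR uE]]].
  have /na : subterm_at (embed D (erase a)) p = Some (embed D u).
    by rewrite subterm_at_embed ap.
  apply; exists (canonical_adp D rl), (@embed S D V \o sigma).
  by split; [exists rl|rewrite uE embed_subst].
- rewrite subterm_at_embed; case ap: subterm_at => [w|] //= [<-].
  move=> [_ [sigma [[rl rlR <-] /(congr1 (@erase S D V))]]].
  rewrite erase_embed erase_subst erase_embed /= => wE.
  by apply: (na _ _ ap); exists rl, (@erase S D V \o sigma).
Qed.

Lemma P_ANF_E a : P_ANF (DP Rs) a <-> ANF Rs (erase a).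
Proof.
split=> na p u p0.
- rewrite subterm_at_erase; case ap: subterm_at => [w|] //= [<-].
  by apply/P_normal_formE/(na _ _ p0 ap).
- move=> ap; apply/P_normal_formE/(na _ _ p0).
  by rewrite subterm_at_erase ap.
Qed.

Lemma adp_step_erase c s mu :
  adp_step (DP Rs) c s mu -> istep Rs (erase s) (mdist_map (@erase S D V) mu).
Proof.
move=> [_ [sigma [p [u [[rl rlR <-] _ [sp uE] anf [_ muE]]]]]].
have eE : subst (@erase S D V \o sigma) (lhs rl) =
          erase (subst sigma (embed D (lhs rl))).
  by rewrite erase_subst erase_embed.
exists p, rl, (@erase S D V \o sigma); split=> //.
- rewrite subterm_at_erase sp /= eE /=; congr Some.
  by rewrite -(congr1 (@erase S D V) uE) flat_erase erase_embed.
- by rewrite eE; apply/P_ANF_E.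
- apply: (perm_trans (perm_map _ muE)); rewrite /mdist_map /= -!map_comp.
  rewrite (eq_map (g := fun x => (x.1, replace_at (erase s) p
    (subst (@erase S D V \o sigma) x.2)))) // => x /=.
  by rewrite erase_contract erase_annotate_defined.
Qed.

(** * The annotation invariant *)

Fixpoint well_annotated a : Prop :=
  match a with
  | Var _ => True
  | App g ts => (symD g -> normal_form Rs (erase a)) /\
                forall i, well_annotated (ts i)
  end.

(** Read contrapositively: a redex is not normal, so its defined root must be annotated. *)
Lemma well_annotated_root s p u (g : ann_signature D) :
  well_annotated s -> subterm_at s p = Some u -> root_symbol u = Some g ->
  symD g -> normal_form Rs (erase u).
Proof.
elim: p s => [|i p IH] [x|h ts] //= was.
- by move=> [<-].
- by move=> [<-] [<-] /was.1.
- by case: insub => // j; apply: IH; exact: was.2.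
Qed.

Lemma well_annotated_embed t : normal_form Rs t -> well_annotated (embed D t).
Proof.
elim: t => [x|f ts IH] nt //; split=> [_|i].
  by move: nt; rewrite -{1}(erase_embed D (App ts)).
apply: IH; apply: (normal_form_sub (p := [:: nat_of_ord i]) nt).
by rewrite subterm_at_cons subterm_at_nil.
Qed.

(* The symbols above a redex are not roots of normal forms, hence annotated. *)
Lemma well_annotated_replace_at s p u r :
  well_annotated s -> subterm_at s p = Some u -> ~ normal_form Rs (erase u) ->
  well_annotated r -> well_annotated (replace_at s p r).
Proof.
move=> + + nu war; elim: p s => [|i p IH] [x|g ts] //= was sp; split.
- move=> Dg; case: nu; apply: (normal_form_sub (p := i :: p) (was.1 Dg)).
  have -> : @App S V (sval g).1 (fun i => erase (ts i)) =
            @erase S D V (App ts) by [].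
  by rewrite subterm_at_erase /= sp.
- move=> j; case: eqP => [ji|_]; last exact: was.2.
  by apply: IH; [exact: was.2|move: sp; rewrite -ji valK].
Qed.

(** All defined symbols of [t] itself are annotated; unannotated ones come only from the
    instantiated variables, which are normal. *)
Lemma well_annotated_subst (sigma : V -> term S V) t :
  (forall x, vars t x -> normal_form Rs (sigma x)) ->
  well_annotated (subst (@embed S D V \o sigma) (annotate_defined D t)).
Proof.
elim: t => [x|f ts IH] nt; first exact/well_annotated_embed/nt.
rewrite annotate_defined_App /=; split.
  by rewrite /symD /= => -[->].
by move=> i; apply: IH => x xi; apply: nt; exists i.
Qed.

Lemma well_annotated_defined t : well_annotated (annotate_defined D t).
Proof.
elim: t => [x|f ts IH] //; rewrite annotate_defined_App /=; split=> //.
by rewrite /symD /= => -[->].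
Qed.

(** * Lifting rewrite steps and trees to annotated terms *)

Hypothesis RsP : forall rl, Rs rl -> is_rule rl.

(** The canonical ADP of the same rule applies at the same position. The last clause allows any
    permutation because the children of a node come in no fixed order. *)
Lemma istep_annotate s mu :
  well_annotated s -> istep Rs (erase s) mu ->
  exists mu' : mdist R (aterm D V),
    [/\ perm_eq mu (mdist_map (@erase S D V) mu'),
        forall x, x \in mu' -> well_annotated x.2 &
        forall nu, perm_eq nu mu' -> adp_step (DP Rs) Case_pr s nu].
Proof.
move=> was [p [rl [sigma [rlR sp anf muE]]]].
have [nvar _ vrl] := RsP rlR.
move: sp; rewrite subterm_at_erase; case sp: subterm_at => [u|] //= [uE].
have nu : ~ normal_form Rs (erase u) by rewrite uE; exact: redex_not_normal.
(* The left-hand side is not a variable, so the redex has a defined root; unannotated, it would make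
   the redex normal. *)
have [g [ug gD gs]] : exists g : ann_signature D,
    [/\ root_symbol u = Some g, (sval g).1 \in D & symDsharp g].
  have : exists f, root_symbol (lhs rl) = Some f /\ f \in D.
    case lE: (lhs rl) nvar => [//|f ts] _.
    by exists f; split=> //; rewrite inE; exists rl; rewrite lE.
  case: (lhs rl) uE => [x|f ts] uE [_ []] //= [<-] fD.
  case: u uE sp nu => // g us uE sp nu; exists g.
  have gf : (sval g).1 = f by case: uE.
  have gD : (sval g).1 \in D by rewrite gf.
  split=> //; apply: contrapT => /negP ngs; apply: nu.
  exact: (well_annotated_root was sp (g := g)).
pose nu' := mdist_map (contract Case_pr s p (@embed S D V \o sigma))
  (mdist_map (@annotate_defined S D V) (rhs rl)).
have eE : (@erase S D V \o (@embed S D V \o sigma)) = sigma.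
  by apply/funext => x /=; rewrite erase_embed.
exists nu'; split.
- apply: (perm_trans muE); rewrite /nu' /mdist_map -!map_comp.
  rewrite [X in perm_eq X _](eq_map (g := fun x => (x.1, erase (contract Case_pr s p
    (@embed S D V \o sigma) (annotate_defined D x.2))))) // => x.
  by rewrite erase_contract erase_annotate_defined eE.
- move=> _ /mapP[_ /mapP[x xrl ->] ->] /=.
  apply: (well_annotated_replace_at was sp nu); apply: well_annotated_subst.
  move=> y /(vrl _ (map_f snd xrl)) /(subterm_at_subst_var sigma) [q [sq q0]].
  by apply: (anf q) => //; apply: q0.
- move=> mu' mu'E; exists (canonical_adp D rl), (@embed S D V \o sigma), p, u.
  split.
  + by exists rl.
  + by exists u, g; split=> //; right.
  + by split=> //; rewrite flat_erase uE embed_subst.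
  + by rewrite -embed_subst; apply/P_ANF_E; rewrite erase_embed.
  + split=> //=; suff -> : p \in positions_of (@symDsharp S D) s by [].
    by rewrite inE; exists u, g.
Qed.

(** Children may share probability and label, so they are matched with the entries of the annotated
    distribution through a permutation of indices, not by value. *)
Lemma annotate_children (T : labeled_tree R (term S V)) (v : node T) s :
  is_RST Rs T -> ~ leaf v -> well_annotated s -> erase s = label v ->
  exists F : node T -> aterm D V,
    (forall w, edge v w -> well_annotated (F w) /\ erase (F w) = label w) /\
    forall ws, children v ws -> adp_step (DP Rs) Case_pr s
      [seq (prob w / prob v, F w) | w <- ws].
Proof.
move=> TR nl was sE; have [ws cws] := children_exist v.
have := TR v ws cws (children_leaf cws nl).
rewrite -sE => /(istep_annotate was)[mu [muE wamu stepmu]].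
pose d0 : R * aterm D V := (0, s).
move: muE; rewrite /children_dist => /(perm_iotaP (0, erase s)).
rewrite size_map => -[Is IsE wsE].
have sz : size Is = size ws by move/(congr1 size): wsE; rewrite !size_map.
have Ilt i : (i < size ws)%N -> (nth 0%N Is i < size mu)%N.
  move=> iws; have := mem_nth 0%N (s := Is) (n := i); rewrite sz => /(_ iws).
  by rewrite (perm_mem IsE) mem_iota.
(* [Is] sends the place of a child [w] in [ws] to its entry in [mu]; by [Ilt] the default [d0] is
   not reached for children. *)
pose F w := (nth d0 mu (nth 0%N Is (index w ws))).2.
have FE w : w \in ws ->
    prob w / prob v = (nth d0 mu (nth 0%N Is (index w ws))).1 /\
    label w = erase (F w).
  move=> wws; have iws : (index w ws < size ws)%N by rewrite index_mem.
  have := congr1 (nth (0, erase s) ^~ (index w ws)) wsE.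
  rewrite (nth_map w) // nth_index // (nth_map 0%N) ?sz //.
  by rewrite (nth_map d0) ?Ilt // => -[].
exists F; split=> [w vw|ws' cws'].
  have wws : w \in ws by rewrite cws.2.
  split; last by case: (FE w wws).
  by apply: wamu; apply: mem_nth; apply: Ilt; rewrite index_mem.
apply: stepmu; apply: (perm_trans (y := [seq (prob w / prob v, F w) | w <- ws])).
  by apply: perm_map; exact: children_perm cws' cws.
apply/(perm_iotaP d0); exists Is; first by [].
apply: (@eq_from_nth _ d0); first by rewrite !size_map.
move=> i; rewrite size_map => iws.
rewrite (nth_map v) // (nth_map 0%N) ?sz //.
have [-> _] := FE _ (mem_nth v iws).
by rewrite /F index_uniq ?cws.1 // -surjective_pairing.
Qed.

Lemma RST_annotation (T : labeled_tree R (term S V)) :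
  is_RST Rs T -> exists l : node T -> aterm D V,
    is_CT (T := relabel l) (DP Rs) [set v | ~ leaf v].
Proof.
move=> TR.
pose Q (v : node T) s := well_annotated s /\ erase s = label v.
(* The labels of the children depend on the label already given to [v], so the choice is over pairs;
   the assumptions sit under the existential to make it total. *)
have /choice[F FP] (vs : node T * aterm D V) :
    exists F : node T -> aterm D V, Q vs.1 vs.2 -> ~ leaf vs.1 ->
    (forall w, edge vs.1 w -> Q w (F w)) /\
    forall ws, children vs.1 ws -> adp_step (DP Rs) Case_pr vs.2
      [seq (prob w / prob vs.1, F w) | w <- ws].
  case: vs => v s /=; have [[[was sE] nl]|nQ] := pselect (Q v s /\ ~ leaf v).
    by have [F FP] := annotate_children TR nl was sE; exists F.
  by exists (fun=> s) => Qv nl; case: nQ.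
have [||l [lQ lE]] := @label_along_tree _ _ T _ Q
    (annotate_defined D (label (root T))) (fun v s => F (v, s)).
- by split; [exact: well_annotated_defined|exact: erase_annotate_defined].
- move=> v w s vw Qv; apply: (FP (v, s) Qv _).1 => // lv.
  by have := lv w; rewrite vw.
exists l; split=> //.
- move=> v ws nl cws; left.
  have := (FP (v, l v) (lQ v) nl).2 ws cws.
  suff -> : [seq (prob w / prob v, F (v, l v) w) | w <- ws] =
            children_dist (T := relabel l) v ws by [].
  apply/eq_in_map => w; rewrite cws.2 => vw /=.
  by rewrite (lE v w vw).
- move=> x xP.
  (* Every node of an infinite path is inner, hence in [V_P]; injectivity of the path then gives
     infinitely many. *)
  have -> : range x `&` [set v | ~ leaf v] = range x.
    apply/seteqP; split=> [v []//|_ [n _ <-]]; split; first by exists n.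
    by move=> /(_ (x n.+1)); rewrite xP.
  have xI := infinite_path_inj xP.
  have xIn : {in [set: nat] &, injective x} by move=> m n _ _ /xI.
  rewrite (eq_finite_set (inj_card_eq xIn)); exact: infinite_nat.
Qed.

End MainProof.

Theorem theorem12 (R : realType) (Sigma : signature) (V : Type)
    (Rs : set (rule R Sigma V)) (hRs : is_PTRS Rs) :
  iAST Rs <-> adp_iAST (DP Rs).
Proof.
split=> [ast T VP [_ stepP stepR _]|ast T TR].
(* The erased tree has the same leaf weight, so only its rewrite steps remain to be checked. *)
- apply: (ast (relabel (fun v : node T => erase (label v)))) => v ws cws ws0.
  have nl : ~ leaf (T := T) v.
    case: ws cws ws0 => // w ws cws _ lv; have := lv w.
    by rewrite -cws.2 mem_head.
  have [c /adp_step_erase] :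
      exists c, adp_step (DP Rs) c (label (v : node T)) (children_dist (T := T) v ws).
    have [vP|vP] := pselect (VP v).
      by case: (stepP v ws vP cws) => ?; eexists; eassumption.
    by case: (stepR v ws nl vP cws) => ?; eexists; eassumption.
  by rewrite /mdist_map /children_dist -map_comp.
- have [l lCT] := RST_annotation hRs.2 TR.
  exact: (ast _ _ lCT).
Qed.
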